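(* Let $0 < a < 1$, let $I \subseteq [0,1)$ be a non-empty interval, and let $\kappa, c, \gamma \in \mathbb{R}$ with $c > 0$ and $\gamma \ne 0$. Define $t_a(x) = (\log_a x)^{-1} = \frac{\log a}{\log x}$ for $x \in (a,1)$. For Lebesgue-almost every $\theta \in (a,1)$, the system \[ \left\| n\theta + \frac{\kappa \theta}{t_a(\theta)\, n^{t_a(\theta) - 1}} \right\| \le \frac{c}{n^{t_a(\theta)-1}}, \qquad \{\gamma n^{t_a(\theta)}\} \in I \] has infinitely many solutions $n \in \mathbb{N}$ if $\theta < \sqrt{a}$, and only finitely many solutions $n \in \mathbb{N}$ if $\theta > \sqrt{a}$.
   Context: $\|x\|$ denotes the distance from $x$ to the nearest integer and $\{x\}$ the fractional part of $x$.
   Formalization: In the ''infinitely many'' half, the interval I is additionally assumed to have non-empty interior; for a single point I = {x} that claim fails, since for almost every θ no n ≥ 2 satisfies {γ n^{t_a(θ)}} = x. *)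

(* Defs.v *)
From HB Require Import structures.
From mathcomp Require Import all_boot all_order all_algebra.
From mathcomp Require Import all_classical all_reals all_analysis.
Set Implicit Arguments.
Unset Strict Implicit.
Unset Printing Implicit Defensive.
Import Order.TTheory GRing.Theory Num.Theory.
Import numFieldNormedType.Exports.
Local Open Scope classical_set_scope.
Local Open Scope ring_scope.

Definition dist_nint (R : realType) (x : R) : R :=
  inf [set `|x - k%:~R| | k in [set: int]].

Definition frac (R : realType) (x : R) : R := x - (Num.floor x)%:~R.

(* The reciprocal of [log_a x]; meaningful on ]a, 1[, where [ln x <> 0]. *)
Definition tlog (R : realType) (a x : R) : R := ln a / ln x.

(* Indices start at 1: at n = 0 the power [0 `^ (t - 1)] in the denominators
   vanishes. *)
Definition solutions (R : realType) (a kappa c gamma : R) (I : set R)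
    (theta : R) : set nat :=
  let t := tlog a theta in
  [set n : nat | [/\ (0 < n)%N,
     dist_nint (n%:R * theta + kappa * theta / (t * n%:R `^ (t - 1)))
       <= c / n%:R `^ (t - 1) &
     I (frac (gamma * n%:R `^ t))]].

(* Main.v *)
(** For [sqrt a < theta] the exponent [t = tlog a theta] exceeds 2, the
shift has the same order [n^(1-t)] as the tolerance, and the convergent half of
the Borel-Cantelli lemma applied to [|n theta - k| < C n^(-1-d)] concludes.

For [theta < sqrt a] we have [1 < t < 2], and the Lebesgue density theorem is
used twice in the following form: if around [x] there are, infinitely often,
intervals contained in [S n], of length proportional to their distance to [x]
and shrinking to [x], then almost every such [x] lies in infinitely many [S n].
First, Dirichlet's theorem gives for every [theta] infinitely many [n] with
[|n theta - k| <= 1/n]; as [1/n^2 <= n^(-t)], the points meeting the first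
condition for this [n] fill an interval of length about [n^(-t)] within distance
[O(n^(-t))] of [theta], in spite of the shift by [kappa].  Second, if [theta]
meets the first condition with constant [c/2], then all points within
[O(n^(-t) / ln n)] meet it with constant [c], while [gamma n^t] runs through more
than one full period modulo 1 there, hence through [I] on a positive
proportion. *)

Require Import Defs.
From HB Require Import structures.
From mathcomp Require Import all_boot all_order all_algebra.
From mathcomp Require Import all_classical all_reals all_analysis.
From mathcomp Require Import ring lra zify.
Set Implicit Arguments.
Unset Strict Implicit.
Unset Printing Implicit Defensive.
Import Order.TTheory GRing.Theory Num.Theory.
Import numFieldNormedType.Exports.
Local Open Scope classical_set_scope.
Local Open Scope ring_scope.

(** * Distance to the nearest integer, finite and infinite sets of naturals *)

Lemma dist_nint_le (R : realType) (x y : R) (k : int) :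
  `|x - k%:~R| <= y -> dist_nint x <= y.
Proof.
apply: le_trans; apply: ge_inf; last by exists k.
by exists 0 => _ [j _ <-].
Qed.

Lemma dist_nint_lt (R : realType) (x y : R) :
  dist_nint x < y -> exists k : int, `|x - k%:~R| < y.
Proof.
move=> xy; have [] := @inf_adherent R [set `|x - k%:~R| | k in [set: int]]
  (y - dist_nint x).
- by rewrite subr_gt0.
- split; first by exists `|x - 0%:~R|, 0.
  by exists 0 => _ [j _ <-].
- move=> _ [k _ <-] xky; exists k; apply: lt_le_trans xky _.
  by rewrite /dist_nint addrC subrK.
Qed.

Lemma unbounded_infinite_set (A : set nat) :
  (forall N : nat, exists2 n, (N <= n)%N & A n) -> infinite_set A.
Proof.
move=> H /finite_setP[m]/card_esym/card_set_bijP[f [fA _ fs]].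
have [n + An] := H (\max_(i < m) f i).+1.
have [i im <-] := fs _ An.
by rewrite ltnNge => /negP; apply; exact: (leq_bigmax (Ordinal im)).
Qed.

Lemma bounded_finite_set (A : set nat) (N : nat) :
  (forall n, A n -> (n < N)%N) -> finite_set A.
Proof. by move=> AN; apply: (@sub_finite_set _ _ `I_N). Qed.

(** * Rational approximation after Dirichlet *)

(** Pigeonhole: the [Q + 1] fractional parts of [i x], [i <= Q], fall into [Q] boxes of length
    [1/Q]; two in one box differ by less than [1/Q], and [q] is the difference of their indices. *)
Lemma dirichlet_approximation (R : realType) (x : R) (Q : nat) : (0 < Q)%N ->
  exists q, (0 < q <= Q)%N /\ exists k : int, `|q%:R * x - k%:~R| < Q%:R^-1.
Proof.
move=> Q0; have Q0r : 0 < Q%:R :> R by rewrite ltr0n.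
pose fr (i : nat) : R := i%:R * x - (Num.floor (i%:R * x))%:~R.
have fr01 i : 0 <= fr i < 1.
  have /andP[f0] := floor_itv (i%:R * x).
  by rewrite /fr subr_ge0 f0 rmorphD/= ltrBlDl.
pose box (i : 'I_Q.+1) := Num.truncn (Q%:R * fr i).
have boxQ i : (box i < Q)%N.
  have /andP[f0 f1] := fr01 i.
  rewrite /box truncn_lt_nat ?mulr_ge0// 1?ltW//.
  by rewrite -[ltRHS]mulr1 ltr_pM2l.
pose g i : 'I_Q := Ordinal (boxQ i).
have /injectivePn[i [j ij gij]] : ~~ injectiveb g.
  apply/negP => /injectiveP/leq_card; by rewrite !card_ord ltnn.
wlog lij : i j ij gij / (i < j)%N.
  move=> W; have [|ji|/val_inj ijE] := ltngtP i j; first exact: W.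
    by apply: (W j i) => //; rewrite eq_sym.
  by rewrite ijE eqxx in ij.
exists (j - i)%N; split.
  by rewrite subn_gt0 lij (leq_trans (leq_subr _ _))// -ltnS.
exists (Num.floor (j%:R * x) - Num.floor (i%:R * x)).
have -> : (j - i)%:R * x - (Num.floor (j%:R * x) - Num.floor (i%:R * x))%:~R
    = fr j - fr i.
  by rewrite natrB ?(ltnW lij)// rmorphB/= /fr; ring.
have bE : box i = box j by case: gij.
have /andP[i0 i1] : (box i)%:R <= Q%:R * fr i < (box i).+1%:R.
  by apply/truncn_itv/mulr_ge0; [exact: ltW | case/andP: (fr01 i)].
have /andP[j0 j1] : (box j)%:R <= Q%:R * fr j < (box j).+1%:R.
  by apply/truncn_itv/mulr_ge0; [exact: ltW | case/andP: (fr01 j)].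
rewrite -(ltr_pM2l Q0r) divff ?gt_eqF// -[X in X * _](gtr0_norm Q0r) -normrM.
move: i0 i1; rewrite bE -natr1 => i0 i1; move: j1; rewrite -natr1 => j1.
by rewrite mulrBr ltr_norml; lra.
Qed.

(** Dirichlet with [Q = N^3]: a denominator [q >= N] serves as it is, since [q <= N^3]; a smaller
    one is multiplied by [N], and the error stays below [N / N^3 <= 1 / (q N)]. Rational and
    irrational [x] are thus treated alike. *)
Lemma arbitrarily_large_approximation (R : realType) (x : R) (N : nat) :
  exists n, [/\ (N <= n)%N, (0 < n)%N &
    exists k : int, `|n%:R * x - k%:~R| <= n%:R^-1].
Proof.
wlog N0 : N / (0 < N)%N.
  by move=> W; have [n [Nn n0 H]] := W N.+1 isT; exists n; split=> //; exact: ltnW.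
have N0r : 0 < N%:R :> R by rewrite ltr0n.
have Q0 : (0 < N ^ 3)%N by rewrite expn_gt0 N0.
have [q [/andP[q0 qQ] [k kq]]] := dirichlet_approximation x Q0.
have q0r : 0 < q%:R :> R by rewrite ltr0n.
have [Nq|qN] := leqP N q.
  exists q; split=> //; exists k; apply/ltW/(lt_le_trans kq).
  by rewrite lef_pV2 ?posrE ?ltr0n ?ler_nat.
exists (q * N)%N; split; rewrite ?muln_gt0 ?q0 ?leq_pmull//.
exists (k * N).
have -> : (q * N)%:R * x - (k * N)%:~R = N%:R * (q%:R * x - k%:~R).
  by rewrite natrM rmorphM/= -pmulrn; ring.
rewrite normrM gtr0_norm// (le_trans (y := N%:R * (N ^ 3)%:R^-1))//; first by rewrite ler_pM2l// ltW.
rewrite natrM -[leRHS]div1r ler_pdivlMr ?mulr_gt0// mulrAC natrX.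
rewrite ler_pdivrMr ?exprn_gt0// mul1r exprS expr2 ler_pM2l//.
by rewrite ler_pM2r// ler_nat ltnW.
Qed.

(** * From balls near a point to infinitely many memberships: Lebesgue density *)

(* The interiors make the exceptional sets closed, so that no measurability of
   the [S n] is needed. *)
Lemma ae_limsup_of_density (R : realType) (S : nat -> set R) :
  {ae (@lebesgue_measure R), forall x : R,
    (exists2 d : R, 0 < d & forall (N : nat) (e : R), 0 < e ->
      exists n r y, [/\ (N <= n)%N, 0 < r < e,
        ball y (d * r) `<=` S n & ball y (d * r) `<=` ball x r]) ->
    forall N : nat, exists2 n, (N <= n)%N & S n x}.
Proof.
pose mu := @lebesgue_measure R.
pose G N : set R := \bigcup_(n in [set n | (N <= n)%N]) (S n)°.
have oG N : open (G N) by apply: bigcup_open => n _; exact: open_interior.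
pose A N : set R := ~` G N.
have mA N : measurable (A N).
  by apply: measurableC; exact: measurable_realfun.open_measurable (oG N).
have muB (z r : R) : 0 < r -> mu (ball z r) = (r *+ 2)%:E.
  by move=> /ltW; exact: lebesgue_measure_ball.
have mB (z r : R) : measurable (ball z r : set R).
  exact: measurable_realfun.measurable_ball.
have := ae_foralln (fun N => lebesgue_density (mA N)).
apply: filterS => x dx [d d0 H] N.
apply: contrapT => noN.
have Ax : A N x.
  by move=> [n /= Nn /interior_subset Snx]; apply: noN; exists n.
have {dx} := dx N; rewrite indicE mem_set// => dx.
(* By density, [A N] fills a proportion above [1 - d] of every small ball about [x]. *)
have : nbhs 1%:E [set y : \bar R | ((1 - d)%:E < y)%E].
  apply: open_nbhs_nbhs; split; first exact: open_ereal_gt_ereal.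
  by rewrite /= lte_fin gtrDl oppr_lt0.
move/dx => [e /= e0 {}dx].
have [n [r [y [Nn /andP[r0 re] BS Bx]]]] := H N e e0.
have := dx r; rewrite /= sub0r normrN gtr0_norm// => /(_ re r0).
rewrite -/mu muB//.
rewrite ltNge => /negP; apply.
have dr0 : 0 < d * r by exact: mulr_gt0.
have BS' : ball y (d * r) `<=` (S n)° by rewrite -open_subsetE//; exact: ball_open.
(* The ball about [y] lies in [G N], so it takes the proportion [d] of [ball x r] away from [A N]: a
   contradiction. *)
have sub : (mu (A N `&` ball x r) + mu (ball y (d * r)) <= mu (ball x r))%E.
  rewrite -measureU//; last 3 first.
  - exact: measurableI (mA N) (mB x r).
  - exact: mB.
  - apply/seteqP; split=> // z [[Az _] Bz]; apply: Az; exists n => //.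
    exact: BS'.
  apply: le_measure; rewrite ?inE.
  - by apply: measurableU (mB _ _); exact: measurableI (mA N) (mB x r).
  - exact: mB.
  - by move=> z [[]|/Bx].
move: sub; rewrite !muB//.
have : (0 <= mu (A N `&` ball x r))%E by [].
case: (mu _) => [m| |] //=.
rewrite inver mulrn_eq0 /= gt_eqF// -EFinD -EFinM !lee_fin => m0 mr.
rewrite ler_pdivrMr ?pmulrn_rgt0//.
by move: mr; rewrite !mulr2n; nra.
Qed.

(** * Finiteness almost everywhere above [sqrt a] *)

(* Telescoping: [(n+1)^(-d) - (n+2)^(-d) >= d (n+2)^(-1-d)]. *)
Lemma riemannR_partial_sum_le (R : realType) (d : R) (n : nat) : 0 < d ->
  \sum_(0 <= i < n) (i.+2%:R `^ (1 + d))^-1 <= d^-1 - (d * n.+1%:R `^ d)^-1 :> R.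
Proof.
move=> d0; elim: n => [|n IH]; first by rewrite big_nil powR1 mulr1 subrr.
rewrite big_nat_recr//= (le_trans (lerD IH (lexx _)))//.
have p1 : 0 < n.+1%:R :> R by rewrite ltr0n.
have p2 : 0 < n.+2%:R :> R by rewrite ltr0n.
have -> : n.+2%:R `^ (1 + d) = n.+2%:R * n.+2%:R `^ d :> R.
  by rewrite powRD ?powRr1 ?ltW// (gt_eqF p2) implybT.
rewrite -addrA lerD2l !invfM.
set u := n.+2%:R `^ d; set v := n.+1%:R `^ d.
have u0 : 0 < u by exact: powR_gt0.
have v0 : 0 < v by exact: powR_gt0.
(* [u / v] is the exponential of [d ln((n+2)/(n+1))]; use [1 + z <= exp z], then
   [ln(1 - 1/(n+2)) <= - 1/(n+2)]. *)
have H : d * n.+2%:R^-1 + 1 <= u / v.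
  rewrite /u /v /powR !gt_eqF// -expRB -mulrBr -ln_div ?posrE//.
  apply: le_trans (expR_ge1Dx _); rewrite addrC lerD2l ler_pM2l//.
  have <- : (n.+1%:R / n.+2%:R)^-1 = n.+2%:R / n.+1%:R :> R.
    by rewrite invfM invrK mulrC.
  rewrite lnV ?posrE ?divr_gt0//.
  have -> : n.+1%:R / n.+2%:R = 1 + - n.+2%:R^-1 :> R.
    rewrite -[in LHS](addrK 1 n.+1%:R) natr1 mulrBl mul1r divff ?gt_eqF//.
  rewrite lerNr le_ln1Dx// ltrN2 invf_lt1// ltr1n//.
have : n.+2%:R^-1 * u^-1 <= d^-1 * (v^-1 - u^-1).
  rewrite ler_pdivlMl//.
  rewrite -(ler_pM2r u0) -mulrA -mulrA mulVf ?gt_eqF// mulr1.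
  by rewrite mulrBl mulVf ?gt_eqF// lerBrDr mulrC (mulrC v^-1) mulrC.
by rewrite mulrBr; move: (_ / u) (_ / v) (_ / u) => X Y Z; lra.
Qed.

Lemma tlog_gt1 (R : realType) (a x : R) : 0 < a -> a < x < 1 -> 1 < tlog a x.
Proof.
move=> a0 /andP[ax x1]; have x0 := lt_trans a0 ax.
have lx : ln x < 0 by apply: ln_lt0; rewrite x0.
by rewrite /tlog ltr_ndivlMr// mul1r ltr_ln ?posrE.
Qed.

Lemma ln_sqrt (R : realType) (a : R) : 0 < a -> ln (Num.sqrt a) = ln a / 2.
Proof. by move=> a0; rewrite -powR12_sqrt ?ltW// ln_powR mulrC. Qed.

Lemma tlog_lt2 (R : realType) (a x : R) :
  0 < a -> a < x < 1 -> x < Num.sqrt a -> tlog a x < 2.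
Proof.
move=> a0 /andP[ax x1] xa; have x0 := lt_trans a0 ax.
have lx : ln x < 0 by apply: ln_lt0; rewrite x0.
move: xa; rewrite -ltr_ln ?posrE ?sqrtr_gt0// ln_sqrt// => h.
by rewrite /tlog ltr_ndivrMr//; lra.
Qed.

Lemma tlog_gt2 (R : realType) (a x : R) :
  0 < a -> a < x < 1 -> Num.sqrt a < x -> 2 < tlog a x.
Proof.
move=> a0 /andP[ax x1] xa; have x0 := lt_trans a0 ax.
have lx : ln x < 0 by apply: ln_lt0; rewrite x0.
move: xa; rewrite -ltr_ln ?posrE ?sqrtr_gt0// ln_sqrt// => h.
by rewrite /tlog ltr_ndivlMr//; lra.
Qed.

(** Borel-Cantelli: the condition puts [x] within [C n^(-2-d)] of some [k/n]. For [x] in [[0, 1]]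
    only [O(n)] numerators occur, so the [n]-th set has measure [O(n^(-1-d))], which is summable. *)
Lemma ae_finite_approximations (R : realType) (C d : R) : 0 < C -> 0 < d ->
  {ae (@lebesgue_measure R), forall x : R, 0 <= x <= 1 -> finite_set
    [set n | (0 < n)%N /\
      exists k : int, `|n%:R * x - k%:~R| < C / n%:R `^ (1 + d)]}.
Proof.
move=> C0 d0; pose mu := @lebesgue_measure R.
pose M := (Num.truncn C).+1.
have CM : C < M%:R by rewrite /M; apply: truncnS_gt.
(* The index [n] stands for the denominator [n + 1]. From [|(n + 1) x - k| < M] and [0 <= x <= 1],
   the shifted numerator [j = k + M] is a natural number below [n + 2 M + 2]. *)
pose r (n : nat) : R := C / n.+1%:R `^ (1 + d) / n.+1%:R.
pose B (n j : nat) : set R := ball ((j%:R - M%:R) / n.+1%:R : R) (r n).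
pose F (n : nat) : set R := \big[setU/set0]_(j < n + 2 * M + 2) B n j.
have r0 n : 0 < r n by rewrite !divr_gt0// powR_gt0.
have mB n j : measurable (B n j) by exact: measurable_realfun.measurable_ball.
have mF n : measurable (F n) by exact: bigsetU_measurable.
pose K : R := C * (4 * M + 4)%:R.
have muF n : (mu (F n) <= (K * (n.+1%:R `^ (1 + d))^-1)%:E)%E.
  have := @content_subadditive _ _ _ mu (F n) (B n) (n + 2 * M + 2)%N.
  move=> /(_ (fun j _ => mB n j) (mF n) (@subset_refl _ _)) => /le_trans; apply.
  have muB j : mu (B n j) = (r n *+ 2)%:E.
    by apply: lebesgue_measure_ball; exact: ltW.
  rewrite (eq_bigr (fun=> (r n *+ 2)%:E)); last by move=> j _; exact: muB.
  rewrite sumEFin lee_fin sumr_const card_ord -mulrnA /r.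
  set p := n.+1%:R `^ _; have p0 : 0 < p by exact: powR_gt0.
  rewrite /K -[leLHS]mulr_natr -!mulrA ler_pM2l// (mulrC _ p^-1) ler_pM2l ?invr_gt0//.
  by rewrite ler_pdivrMl// -natrM ler_nat; nia.
have sF : (\sum_(n <oo) mu (F n) < +oo)%E.
  apply: (@le_lt_trans _ _ (K * (1 + d^-1))%:E); last exact: ltry.
  apply: lime_le; first exact: is_cvg_nneseries.
  apply: nearW => n.
  rewrite (le_trans (lee_sum _ (fun i _ => muF i)))//.
  rewrite sumEFin lee_fin -mulr_sumr ler_pM2l ?mulr_gt0 ?ltr0n ?addnS//.
  (* The term with base 1 is split off; it accounts for the summand 1 in [1 + d^-1]. *)
  case: n => [|n]; first by rewrite big_nil addr_ge0// invr_ge0 ltW.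
  rewrite big_nat_recl// powR1 invr1 lerD2l.
  apply: le_trans (riemannR_partial_sum_le n d0) _.
  by rewrite gerBl invr_ge0 mulr_ge0 ?powR_ge0// ltW.
have F0 : mu (lim_sup_set F) = 0%E by exact: lim_sup_set_cvg0.
exists (lim_sup_set F); split=> //.
  apply: (@bigcap_measurableType _ (measurableTypeR R)) => n _.
  by apply: (@bigcup_measurable _ (measurableTypeR R)) => m _; exact: mF.
move=> x /= nx; apply: contrapT => xF; apply: nx => x01.
have [n Hn] : exists n, forall m, (n <= m)%N -> ~ F m x.
  apply: contrapT => h; apply: xF => n _; apply: contrapT => h'.
  by apply: h; exists n => m nm Fm; apply: h'; exists m.
apply: (@bounded_finite_set _ n.+1) => -[[]//|m] [_ [k kx]].
rewrite ltnS ltnNge; apply/negP => /Hn; apply.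
have m0 : 0 < m.+1%:R :> R by [].
have kC : `|m.+1%:R * x - k%:~R| < M%:R.
  apply: (lt_trans kx); apply: le_lt_trans CM.
  rewrite ler_pdivrMr ?powR_gt0// ler_peMr//; first exact: ltW.
  by rewrite -[leLHS](powRr0 m.+1%:R) ler_powR ?ler1n// addr_ge0// ltW.
have /andP[x0 x1] := x01.
have kM : 0 <= k + M%:Z.
  rewrite -(ler0z R) rmorphD/=; have := mulr_ge0 (ltW m0) x0.
  by move: kC; rewrite ltr_norml -pmulrn => /andP[]; lra.
have kM' : k + M%:Z < (m + 2 * M + 2)%N%:Z.
  rewrite -(ltr_int R) rmorphD/= -!pmulrn !natrD natrM.
  have := ler_wpM2l (ltW m0) x1; move: kC; rewrite ltr_norml -natr1 => /andP[].
  by move: (_ * x) => y; lra.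
move: kM kM'; case E: (k + M%:Z) => [j|//] _ jM.
have kE : k%:~R = j%:R - M%:R :> R.
  by rewrite -(addrK M%:Z k) E rmorphB.
have jM' : (j < m + 2 * M + 2)%N by lia.
rewrite /F -bigcup_mkord; exists j => //=.
rewrite /B /ball /= -kE distrC /r -(ltr_pM2l m0).
rewrite -[X in X * `| _ |](gtr0_norm m0) -normrM mulrBr (mulrCA _ k%:~R).
by rewrite mulfV ?gt_eqF// mulr1 mulrCA mulfV ?gt_eqF// mulr1.
Qed.

(** As [0 < x / t <= 1], moving the shift to the right-hand side gives
    [|n x - k| < (c + 1 + |kappa|) / n^(t-1)], where [t - 1 > 1]. *)
Lemma ae_finite_solutions (R : realType) (a kappa c gamma : R) (I : set R) :
  0 < a -> 0 < c ->
  {ae (@lebesgue_measure R), forall x : R, a < x < 1 ->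
    Num.sqrt a < x -> finite_set (solutions a kappa c gamma I x)}.
Proof.
move=> a0 c0.
(* Since [t] varies with [x], the null sets for the countably many pairs [C = j + 1],
   [d = 1 / (j + 1)] are united first. *)
have H j := @ae_finite_approximations R j.+1%:R j.+1%:R^-1 (ltr0Sn _ _)
  (eq_ind_r is_true (ltr0Sn _ _) (invr_gt0 _)).
have := ae_foralln H; apply: filterS => x {}H xa1 ax.
have t2 := tlog_gt2 a0 xa1 ax.
have /andP[xa x1] := xa1; have x0 := lt_trans a0 xa.
set t := tlog a x in t2 *.
have : 0 < (t - 2)^-1 by rewrite invr_gt0 subr_gt0.
have : (t - 2)^-1^-1 = t - 2 by rewrite invrK.
move: (t - 2)^-1 => s st s0.
(* Here [s = 1 / (t - 2)]: the choice makes [j + 1] exceed [c + 1 + |kappa|] and [1 / (j + 1)] at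
   most [t - 2]. *)
pose j := Num.truncn (c + 1 + `|kappa| + s).
have jlt : c + 1 + `|kappa| + s < j.+1%:R by apply: truncnS_gt.
have t0 : 0 < t by lra.
have k0 := normr_ge0 kappa.
have jC : c + 1 + `|kappa| < j.+1%:R by lra.
have jt : 1 + j.+1%:R^-1 <= t - 1.
  suff : j.+1%:R^-1 <= t - 2 by move: (_^-1) => y; lra.
  by rewrite -st lef_pV2 ?posrE//; lra.
apply: sub_finite_set (H j _); last by rewrite !ltW.
move=> n [n0 nc _]; split=> //.
have n1 : 1 <= n%:R :> R by rewrite ler1n.
have nr0 : 0 < n%:R :> R by rewrite ltr0n.
have p0 : 0 < n%:R `^ (t - 1) :> R by exact: powR_gt0.
(* [dist_nint] is an infimum, and a strict bound is what yields an integer; hence the extra 1. *)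
have /dist_nint_lt[k] : dist_nint (n%:R * x + kappa * x / (t * n%:R `^ (t - 1)))
    < (c + 1) / n%:R `^ (t - 1).
  by apply: (le_lt_trans nc); rewrite ltr_pM2r ?invr_gt0//; lra.
set p := n%:R `^ (t - 1) in p0 *; set K := kappa * x / _ => kn.
exists k; apply: (@lt_le_trans _ _ ((c + 1 + `|kappa|) / p)).
  have -> : n%:R * x - k%:~R = n%:R * x + K - k%:~R - K by ring.
  apply: le_lt_trans (ler_normB _ _) _; rewrite mulrDl ltr_leD//.
  rewrite /K invfM mulrA normrM (gtr0_norm (_ : 0 < p^-1)) ?invr_gt0//.
  rewrite ler_pM2r ?invr_gt0// -mulrA normrM ler_piMr//.
  have xt0 : 0 < x / t by exact: divr_gt0.
  by rewrite gtr0_norm// (_ : x / t <= 1)// ler_pdivrMr// mul1r; lra.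
apply: ler_pM.
- lra.
- by rewrite invr_ge0 ltW.
- exact: ltW.
- by rewrite lef_pV2 ?posrE ?powR_gt0// ler_powR.
Qed.

(** * Elementary estimates *)

Lemma powRN_small (R : realType) (b e : R) : 0 < b -> 0 < e ->
  exists N : nat, forall n, (N <= n)%N -> n%:R `^ (- b) <= e.
Proof.
move=> b0 e0; pose M : R := e^-1 `^ b^-1.
exists (Num.truncn M).+1 => n Nn.
have M0 : 0 < M by rewrite powR_gt0 ?invr_gt0.
have Mn : M < n%:R by apply: (lt_le_trans (truncnS_gt M)); rewrite ler_nat.
have n0 := lt_trans M0 Mn.
rewrite powRN -[leRHS]invrK lef_pV2 ?posrE ?invr_gt0 ?powR_gt0//.
have <- : M `^ b = e^-1.
  by rewrite -powRrM mulVf ?gt_eqF// powRr1// invr_ge0 ltW.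
by apply: ge0_ler_powR; rewrite ?nnegrE ltW.
Qed.

Lemma ln_nat_large (R : realType) (M : R) :
  exists N : nat, forall n, (N <= n)%N -> M <= ln n%:R.
Proof.
exists (Num.truncn (expR M)).+1 => n Nn.
have Mn : expR M < n%:R.
  by apply: (lt_le_trans (truncnS_gt _)); rewrite ler_nat.
have n0 := lt_trans (expR_gt0 M) Mn.
by rewrite -ler_expR lnK ?posrE// ltW.
Qed.

Lemma expR_sub1_le (R : realType) (z : R) : `|z| <= 2^-1 ->
  `|expR z - 1| <= 2 * `|z|.
Proof.
rewrite ler_norml => /andP[z1 z2].
have h1 := expR_ge1Dx z; have h2 := expR_ge1Dx (- z).
have e0 := expR_gt0 z; have := expRxMexpNx_1 z.
set E := expR z in h1 e0 *; set E' := expR (- z) in h2 * => EE.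
have h3 : E * (1 - z) <= 1 by rewrite -[leRHS]EE ler_pM2l.
have [z0|z0] := leP 0 z.
  by rewrite (ger0_norm z0) ler_norml; apply/andP; split; nra.
by rewrite (ltr0_norm z0) ler_norml; apply/andP; split; nra.
Qed.

(** * The exponent as a coordinate on []a, sqrt a[] *)

(** This is [a^(1/s)], the inverse function of [tlog a]. *)
Definition theta_of (R : realType) (a s : R) : R := expR (ln a / s).

Lemma theta_ofK (R : realType) (a s : R) : 0 < a < 1 -> tlog a (theta_of a s) = s.
Proof.
move=> /ln_lt0 la; rewrite /tlog /theta_of expRK invf_div mulrCA.
by rewrite mulfV ?mulr1// lt_eqF.
Qed.

Lemma tlogK (R : realType) (a x : R) : 0 < a < 1 -> 0 < x ->
  theta_of a (tlog a x) = x.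
Proof.
move=> /ln_lt0 la x0; rewrite /tlog /theta_of invf_div mulrCA.
by rewrite mulfV ?mulr1 ?lt_eqF// lnK ?posrE.
Qed.

(** The derivative of [a^(1/s)] is [- ln a * a^(1/s) / s^2], with [a <= a^(1/s) <= 1] and
    [1 <= s <= 2]. The proof uses [1 + z <= exp z] at [z] and [- z] instead, [z] being the increment
    of [ln a / s]. *)
Lemma theta_of_lip (R : realType) (a s1 s2 : R) : 0 < a < 1 ->
  1 <= s1 -> s1 <= s2 -> s2 <= 2 ->
  a * - ln a / 4 * (s2 - s1) <= theta_of a s2 - theta_of a s1
    <= - ln a * (s2 - s1).
Proof.
move=> a01 s11 s12 s22; have /andP[a0 _] := a01; have la := ln_lt0 a01.
have s10 : 0 < s1 by lra.
have s20 : 0 < s2 by lra.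
pose z := ln a / s2 - ln a / s1.
have ss1 : 1 <= s1 * s2 by nra.
have ss4 : s1 * s2 <= 4 by nra.
have zE : z * (s1 * s2) = - ln a * (s2 - s1).
  by rewrite /z; field; rewrite !gt_eqF.
have z0 : 0 <= z by rewrite -(pmulr_lge0 _ (_ : 0 < s1 * s2)) ?zE; nra.
have zl : - ln a * (s2 - s1) <= z * 4 by rewrite -zE ler_wpM2l.
have zu : z <= - ln a * (s2 - s1) by rewrite -zE ler_peMr.
have E2 : theta_of a s2 = theta_of a s1 * expR z.
  by rewrite /theta_of /z -expRD addrC subrK.
have E1 : theta_of a s1 = theta_of a s2 * expR (- z).
  by rewrite E2 -mulrA expRxMexpNx_1 mulr1.
have g1 : a <= theta_of a s1.
  rewrite /theta_of -[leLHS]lnK ?posrE// ler_expR ler_pdivlMr//; nra.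
have g2 : theta_of a s2 <= 1.
  by rewrite /theta_of -expR0 ler_expR pmulr_lle0 ?invr_gt0// ltW.
have g20 : 0 < theta_of a s2 by exact: expR_gt0.
have h1 := expR_ge1Dx z; have h2 := expR_ge1Dx (- z).
apply/andP; split.
  rewrite E2; move: (theta_of a s1) (expR z) g1 h1 => g E g1 h1.
  have : a * z <= g * (E - 1) by apply: ler_pM; lra.
  by nra.
rewrite E1; move: (theta_of a s2) (expR (- z)) g2 g20 h2 => g E g2 g20 h2.
have h3 : g * (1 - E) <= g * z by rewrite ler_pM2l//; lra.
have h4 : g * z <= z by rewrite ler_piMl.
by lra.
Qed.

Lemma lt_sqrt_lt1 (R : realType) (a x : R) : 0 < a -> a < 1 ->
  x < Num.sqrt a -> x < 1.
Proof.
by move=> a0 a1 /lt_trans; apply; rewrite -sqrtr1 ltr_sqrt.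
Qed.

(** The lower bound of [theta_of_lip], read for the inverse function. *)
Lemma tlog_lip (R : realType) (a x y : R) : 0 < a < 1 ->
  a < x < Num.sqrt a -> a < y < Num.sqrt a ->
  `|tlog a x - tlog a y| <= 4 / (a * - ln a) * `|x - y|.
Proof.
move=> a01; have /andP[a0 a1] := a01; have la := ln_lt0 a01.
wlog xy : x y / tlog a x <= tlog a y.
  move=> W hx hy; have [/W|/ltW/W] := leP (tlog a x) (tlog a y); first exact.
  by rewrite distrC (distrC x); apply.
move=> /andP[ax xa] /andP[ay ya].
have x1 := lt_sqrt_lt1 a0 a1 xa; have y1 := lt_sqrt_lt1 a0 a1 ya.
have tx1 : 1 < tlog a x by apply: tlog_gt1 => //; rewrite ax.
have ty2 : tlog a y < 2 by apply: tlog_lt2 => //; rewrite ay.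
have := theta_of_lip a01 (ltW tx1) xy (ltW ty2).
rewrite (tlogK a01 (lt_trans a0 ax)) (tlogK a01 (lt_trans a0 ay)) => /andP[h _].
have ala : 0 < a * - ln a by rewrite mulr_gt0 ?oppr_gt0.
have -> : 4 / (a * - ln a) * `|x - y| = `|x - y| * 4 / (a * - ln a).
  by rewrite mulrC mulrA.
rewrite ler_pdivlMr// distrC ger0_norm ?subr_ge0// distrC.
apply: le_trans (_ : (y - x) * 4 <= _); first by move: h; lra.
by rewrite ler_pM2r// ler_norm.
Qed.

(** * The first condition below [sqrt a] *)

(* [n^(t-1)] times the difference between the shifted multiple
   [n x + kappa x / (t n^(t-1))] and the integer [k]. *)
Definition scaled_error (R : realType) (a kappa : R) (n : nat) (k : int)
    (x : R) : R :=
  n%:R `^ (tlog a x - 1) * (n%:R * x - k%:~R) + kappa * x / tlog a x.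

(** Moving [x] by [O(n^(-t0))] moves [t] by [O(n^(-t0))], so [n^(t - t0) = exp((t - t0) ln n) = 1 +
    O(n^(1 - t0))] because [ln n <= n]. With the exponent frozen at [t0], the scaled error is affine
    in [x] up to [e]. *)
Lemma scaled_error_perturb (R : realType) (a kappa x0 D e : R) : 0 < a < 1 ->
  a < x0 < Num.sqrt a -> 0 < D -> 0 < e ->
  let t0 := tlog a x0 in
  exists N : nat, forall n, (N <= n)%N -> (0 < n)%N -> forall (k : int) (x : R),
    `|x - x0| <= D * n%:R `^ (- t0) ->
    `|n%:R `^ (t0 - 1) * (n%:R * x - k%:~R)| <= D ->
    a < x < Num.sqrt a /\
    `|scaled_error a kappa n k x -
      (n%:R `^ (t0 - 1) * (n%:R * x - k%:~R) + kappa * x0 / t0)| <= e.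
Proof.
move=> a01 x0a D0 e0 t0; have /andP[a0 a1] := a01.
have /andP[ax0 xa0] := x0a; have x01 := lt_sqrt_lt1 a0 a1 xa0.
have x0_gt0 := lt_trans a0 ax0.
have t01 : 1 < t0 by apply: tlog_gt1 => //; rewrite ax0.
pose K := 4 / (a * - ln a).
have K0 : 0 < K by rewrite divr_gt0// mulr_gt0// oppr_gt0 ln_lt0.
have kap0 := normr_ge0 kappa.
(* The total error is [L n^(1 - t0)]: the first term comes from freezing the power, the second from
   freezing [kappa x / t]. *)
pose L := 2 * K * D * D + `|kappa| * (1 + K) * D.
have KD0 : 0 < K * D by exact: mulr_gt0.
have L0 : 0 < L.
  have h1 : 0 <= `|kappa| * (1 + K) * D.
    by rewrite mulr_ge0 ?(ltW D0)// mulr_ge0//; lra.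
  have h2 : 0 < 2 * K * D * D.
    by apply: mulr_gt0 => //; apply: mulr_gt0 => //; lra.
  by rewrite /L; lra.
have t010 : 0 < t0 - 1 by lra.
have small d C : 0 < d -> 0 < C -> exists N : nat, forall n, (N <= n)%N ->
    C * n%:R `^ (- (t0 - 1)) <= d.
  move=> d0 C0; have [N HN] := powRN_small t010 (divr_gt0 d0 C0).
  by exists N => n /HN; rewrite ler_pdivlMr// mulrC.
have [N1 HN1] : exists N : nat, forall n, (N <= n)%N ->
    D * n%:R `^ (- (t0 - 1)) <= (x0 - a) / 2 by apply: small; rewrite ?divr_gt0 ?subr_gt0.
have [N2 HN2] : exists N : nat, forall n, (N <= n)%N ->
    D * n%:R `^ (- (t0 - 1)) <= (Num.sqrt a - x0) / 2 by apply: small; rewrite ?divr_gt0 ?subr_gt0.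
have [N3 HN3] : exists N : nat, forall n, (N <= n)%N ->
    K * D * n%:R `^ (- (t0 - 1)) <= 2^-1 by apply: small.
have [N4 HN4] := small e L e0 L0.
exists (maxn (maxn N1 N2) (maxn N3 N4)) => n.
rewrite !geq_max => /andP[/andP[/HN1 h1 /HN2 h2] /andP[/HN3 h3 /HN4 h4]].
move=> {HN1 HN2 HN3 HN4} n0 k x xx0 nk.
have n0r : 0 < n%:R :> R by rewrite ltr0n.
set eta := n%:R `^ (- (t0 - 1)) in h1 h2 h3 h4.
have etaE : eta = n%:R * n%:R `^ (- t0).
  rewrite /eta opprB powRD ?powRr1 ?ltW//.
  by rewrite (gt_eqF n0r) implybT.
set w := n%:R `^ (- t0) in xx0 etaE.
have w0 : 0 < w by exact: powR_gt0.
have eta0 : 0 < eta by exact: powR_gt0.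
have weta : w <= eta by rewrite etaE ler_peMl ?ler1n// (ltW w0).
have lnw : ln n%:R * w <= eta.
  by rewrite etaE ler_pM2r// ltW// ln_sublinear.
have ln0 : 0 <= ln n%:R :> R by rewrite ln_ge0// ler1n.
have xx0' : `|x - x0| <= D * eta.
  by apply: (le_trans xx0); rewrite ler_pM2l.
have xa : a < x < Num.sqrt a.
  by move: xx0'; rewrite ler_norml => /andP[]; lra.
split=> //; rewrite /scaled_error.
have /andP[ax xsa] := xa; have x1 := lt_sqrt_lt1 a0 a1 xsa.
have x_gt0 := lt_trans a0 ax.
have tlip := tlog_lip a01 xa x0a; rewrite -/K -/t0 in tlip.
have t1 : 1 < tlog a x by apply: tlog_gt1 => //; rewrite ax.
set t := tlog a x in tlip t1 *.
set Z := n%:R * x - k%:~R in nk *.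
have tt0 : `|t - t0| <= K * D * w.
  by apply: (le_trans tlip); rewrite -mulrA ler_pM2l.
have tln : `|(t - t0) * ln n%:R| <= K * D * eta.
  rewrite normrM (ger0_norm ln0).
  apply: (@le_trans _ _ (K * D * w * ln n%:R)); first by rewrite ler_wpM2r.
  by rewrite -mulrA ler_pM2l// mulrC.
have := expR_sub1_le (le_trans tln h3).
set E := expR _ => HE.
have pE : n%:R `^ (t - 1) = E * n%:R `^ (t0 - 1).
  rewrite /E -[expR _](_ : n%:R `^ (t - t0) = _); last first.
    by rewrite /powR gt_eqF.
  rewrite -powRD; last by rewrite (gt_eqF n0r) implybT.
  by congr (_ `^ _); ring.
have -> : n%:R `^ (t - 1) * Z + kappa * x / t
    - (n%:R `^ (t0 - 1) * Z + kappa * x0 / t0)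
    = (E - 1) * (n%:R `^ (t0 - 1) * Z) + kappa * (x / t - x0 / t0).
  by rewrite pE; ring.
have B1 : `|(E - 1) * (n%:R `^ (t0 - 1) * Z)| <= 2 * (K * D * eta) * D.
  rewrite normrM ler_pM//; apply: (le_trans HE).
  by rewrite ler_pM2l.
have B2 : `|x / t - x0 / t0| <= (1 + K) * D * eta.
  have -> : x / t - x0 / t0 = (x - x0) / t + (x0 / t0) * ((t0 - t) / t).
    by field; rewrite !gt_eqF//; lra.
  have bd y : `|y / t| <= `|y|.
    have t_gt0 : 0 < t by lra.
    rewrite normrM normfV (gtr0_norm t_gt0) ler_pdivrMr// ler_peMr//.
    exact: ltW.
  have xt : `|x0 / t0| <= 1.
    have xt0 : 0 < x0 / t0 by apply: divr_gt0 => //; lra.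
    by rewrite gtr0_norm// ler_pdivrMr; lra.
  have ->: (1 + K) * D * eta = D * eta + K * D * eta by ring.
  apply: le_trans (ler_normD _ _) (lerD _ _).
    exact: le_trans (bd _) xx0'.
  rewrite normrM -[leRHS]mul1r ler_pM//.
  apply: (le_trans (bd _)); rewrite distrC (le_trans tt0)// ler_pM2l//.
have B3 : `|kappa * (x / t - x0 / t0)| <= `|kappa| * ((1 + K) * D * eta).
  by rewrite normrM ler_wpM2l.
apply: le_trans (ler_normD _ _) _; apply: le_trans (lerD B1 B3) _.
apply: le_trans h4; rewrite /L.
by rewrite le_eqVlt; apply/orP; left; apply/eqP; ring.
Qed.

Lemma ae_scaled_error_le (R : realType) (a kappa c : R) : 0 < a < 1 -> 0 < c ->
  {ae (@lebesgue_measure R), forall x : R, a < x < Num.sqrt a ->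
    forall N : nat, exists2 n, (N <= n)%N &
      (0 < n)%N /\ exists k : int, `|scaled_error a kappa n k x| <= c}.
Proof.
move=> a01 c0; have /andP[a0 a1] := a01.
have := @ae_limsup_of_density R (fun n =>
  [set x | (0 < n)%N /\ exists k : int, `|scaled_error a kappa n k x| <= c]).
apply: (@filterS _ _ (ae_filter_ringOfSetsType (@lebesgue_measure R))) => x0 H x0a.
apply: H.
have /andP[ax0 xa0] := x0a; have x01 := lt_sqrt_lt1 a0 a1 xa0.
have x0_gt0 := lt_trans a0 ax0.
set t0 := tlog a x0.
have t01 : 1 < t0 by apply: tlog_gt1 => //; rewrite ax0.
have t02 : t0 < 2 by apply: tlog_lt2 => //; rewrite ax0.
have kap0 := normr_ge0 kappa.
(* In units of [n^(-t0)]: the radius about [y], the shift by [kappa], and the distance from [k/n] to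
   [x0]. *)
pose D := c / 2 + `|kappa| + 1.
have D0 : 0 < D by rewrite /D; lra.
have c20 : 0 < c / 2 by lra.
have [N0 HN0] := scaled_error_perturb kappa a01 x0a D0 c20.
rewrite /= -/t0 in HN0.
exists (c / 2 / D) => [|N e e0]; first exact: divr_gt0.
have t00 : 0 < t0 by lra.
have [N1 HN1] := powRN_small t00 (divr_gt0 e0 (mulr_gt0 (ltr0Sn R 1) D0)).
have [n [Nn n0 [k nk]]] := arbitrarily_large_approximation x0 (maxn N (maxn N0 N1)).
move: Nn; rewrite !geq_max => /and3P[Nn N0n /HN1 wsmall].
have n0r : 0 < n%:R :> R by rewrite ltr0n.
set w := n%:R `^ (- t0) in wsmall.
have w0 : 0 < w by exact: powR_gt0.
pose y := k%:~R / n%:R - kappa * x0 / t0 * w.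
have kx0 : `|kappa * x0 / t0| <= `|kappa|.
  have xt0 : 0 < x0 / t0 by exact: divr_gt0.
  by rewrite -mulrA normrM ler_piMr// gtr0_norm// ler_pdivrMr; lra.
have kn : `|k%:~R / n%:R - x0| <= w.
  have -> : k%:~R / n%:R - x0 = - ((n%:R * x0 - k%:~R) / n%:R).
    by field; rewrite gt_eqF.
  rewrite normrN normrM normfV (gtr0_norm n0r).
  apply: (@le_trans _ _ (n%:R^-1 / n%:R)); first by rewrite ler_pM2r ?invr_gt0.
  have -> : n%:R^-1 / n%:R = n%:R `^ (- 2) :> R.
    by rewrite powR_invn ?ltW// -invfM -expr2.
  by rewrite /w ler_powR ?ler1n//; lra.
pose W := n%:R `^ t0.
have W0 : 0 < W by exact: powR_gt0.
have Ww : W * w = 1 by rewrite /W /w powRN mulfV ?gt_eqF.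
have xD x : `|y - x| < c / 2 * w -> `|x - x0| < D * w.
  move=> yx; have -> : x - x0 = (- (y - x) - kappa * x0 / t0 * w)
      + (k%:~R / n%:R - x0) by rewrite /y; ring.
  apply: le_lt_trans (ler_normD _ _) _.
  apply: (@lt_le_trans _ _ ((c / 2 * w + `|kappa| * w) + w)); last first.
    by rewrite /D; lra.
  apply: ltr_leD => //; apply: le_lt_trans (ler_normB _ _) _.
  by rewrite normrN normrM (gtr0_norm w0) ltr_leD// ler_pM2r.
exists n, (D * w), y; split => //.
- rewrite mulr_gt0//=; apply: (@le_lt_trans _ _ (e / 2)).
    have -> : e / 2 = D * (e / (2 * D)) by field; rewrite gt_eqF.
    by rewrite ler_pM2l.
  by lra.
- rewrite mulrA divfK ?gt_eqF// => x; rewrite /ball/= => yx.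
  split=> //; exists k.
  have E : n%:R `^ (t0 - 1) * (n%:R * x - k%:~R)
      = - (W * (y - x)) - kappa * x0 / t0.
    rewrite [in RHS](_ : kappa * x0 / t0 = W * w * (kappa * x0 / t0)); last first.
      by rewrite Ww mul1r.
    have -> : W = n%:R * n%:R `^ (t0 - 1) by rewrite mulr_powRB1 ?ltW.
    rewrite /y; move: (_ `^ (t0 - 1)) => p.
    by field; rewrite !gt_eqF.
  have Wyx : `|W * (y - x)| <= c / 2.
    have -> : c / 2 = W * (c / 2 * w) by rewrite mulrCA Ww mulr1.
    by rewrite normrM (gtr0_norm W0) ler_pM2l// ltW.
  have [|_] := HN0 n N0n n0 k x (ltW (xD x yx)).
    rewrite E (le_trans (ler_normB _ _))// normrN /D.
    by move: kx0 Wyx; lra.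
  rewrite E subrK => H1.
  rewrite -[X in `|X|](subrK (- (W * (y - x)))) (le_trans (ler_normD _ _))//.
  by rewrite normrN; move: H1 Wyx; lra.
- rewrite mulrA divfK ?gt_eqF// => x; rewrite /ball/= => yx.
  by rewrite distrC; exact: xD.
Qed.

(** * The second condition below [sqrt a] *)

(** Within one period [1 / |gamma|] after [w0], the product [gamma w] enters a translate of
    [[u, v]], at the end [u] or [v] according to the sign of [gamma]; crossing it takes at most one
    more period. *)
Lemma frac_window (R : realType) (gamma u v w0 : R) :
  gamma != 0 -> u < v -> v <= u + 1 ->
  exists (j : int) (w1 w2 : R), [/\ w0 <= w1, w2 <= w0 + 2 / `|gamma|,
    w2 - w1 = (v - u) / `|gamma| &
    forall w, w1 <= w <= w2 -> u <= gamma * w - j%:~R <= v].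
Proof.
move=> g0 uv vu; have [gp|gn] := ltP 0 gamma.
  exists (Num.floor (gamma * w0 - u) + 1).
  have /andP[f1 f2] := floor_itv (gamma * w0 - u).
  set j := (Num.floor _ + 1) in f2 *.
  have jE : (Num.floor (gamma * w0 - u))%:~R = j%:~R - 1 :> R.
    by rewrite /j rmorphD/= addrK.
  rewrite jE in f1.
  exists ((j%:~R + u) / gamma), ((j%:~R + v) / gamma).
  rewrite (gtr0_norm gp); split.
  - by rewrite ler_pdivlMr// mulrC; lra.
  - rewrite ler_pdivrMr// mulrDl divfK//; lra.
  - by rewrite -mulrBl; congr (_ / _); ring.
  - by move=> w /andP[]; rewrite ler_pdivrMr// ler_pdivlMr// mulrC => ? ?; lra.
have {}gn : gamma < 0 by rewrite lt_neqAle g0.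
exists (Num.floor (gamma * w0 - v)).
have /andP[f1 f2] := floor_itv (gamma * w0 - v).
rewrite rmorphD/= in f2.
set j := Num.floor _ in f1 f2 *.
exists ((j%:~R + v) / gamma), ((j%:~R + u) / gamma).
rewrite (ltr0_norm gn); split.
- by rewrite ler_ndivlMr// mulrC; lra.
- by rewrite ler_ndivrMr// mulrDl invrN mulrN mulNr divfK//; lra.
- by rewrite -mulrBl invrN mulrN -mulNr; congr (_ / _); ring.
- by move=> w /andP[]; rewrite ler_ndivrMr// ler_ndivlMr// mulrC => ? ?; lra.
Qed.

Lemma frac_eq (R : realType) (x : R) (j : int) : 0 <= x - j%:~R < 1 ->
  Defs.frac x = x - j%:~R.
Proof.
move=> /andP[h1 h2]; rewrite /Defs.frac (@floor_def _ _ j)// rmorphD/=.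
by apply/andP; split; lra.
Qed.

Lemma ltr_powR_nat (R : realType) (n : nat) : (1 < n)%N ->
  {homo (fun s : R => n%:R `^ s) : x y / x < y}.
Proof.
move=> n1 x y xy; have n0 : 0 < n%:R :> R by rewrite ltr0n ltnW.
by rewrite /powR gt_eqF// ltr_expR ltr_pM2r// ln_gt0// ltr1n.
Qed.

Lemma tlog_lt (R : realType) (a x y : R) : 0 < a < 1 -> 0 < x -> x < y ->
  y < 1 -> tlog a x < tlog a y.
Proof.
move=> a01 x0 xy y1; have la := ln_lt0 a01; have y0 := lt_trans x0 xy.
have lx : ln x < 0 by rewrite ln_lt0// x0 (lt_trans xy).
have ly : ln y < 0 by rewrite ln_lt0// y0.
by rewrite /tlog ltr_nM2l// ltf_nV2 ?negrE// ltr_ln ?posrE.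
Qed.

Lemma ln_sub_le (R : realType) (x y : R) : 0 < x -> 0 < y ->
  ln y - ln x <= (y - x) / x.
Proof.
move=> x0 y0; rewrite -ln_div ?posrE//.
have -> : y / x = 1 + (y - x) / x by field; rewrite gt_eqF.
apply: le_ln1Dx; rewrite mulrBl divff ?gt_eqF//.
by have := divr_gt0 y0 x0; lra.
Qed.

(* Here [q] is the order of magnitude of the length of an interval of values of
   [x] over which [gamma n^(tlog a x)] increases by 1: moving [x] by [q] moves
   [n^(tlog a x)] by about [1 / |gamma|]. *)
Lemma frac_interval (R : realType) (a gamma u v x0 : R) : 0 < a < 1 ->
  gamma != 0 -> u < v -> v <= u + 1 -> a < x0 < Num.sqrt a ->
  exists N : nat, forall n, (N <= n)%N ->
    let q := - ln a / (`|gamma| * n%:R `^ tlog a x0 * ln n%:R) in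
    exists (j : int) (x1 x2 : R), [/\ x0 <= x1, x2 <= x0 + 2 * q,
      a * (v - u) / 8 * q <= x2 - x1 &
      forall x, x1 < x < x2 -> u <= gamma * n%:R `^ tlog a x - j%:~R <= v].
Proof.
move=> a01 g0 uv vu x0a; have /andP[a0 a1] := a01; have la := ln_lt0 a01.
have /andP[ax0 xa0] := x0a; have x01 := lt_sqrt_lt1 a0 a1 xa0.
have x0_gt0 := lt_trans a0 ax0.
set t0 := tlog a x0.
have t01 : 1 < t0 by apply: tlog_gt1 => //; rewrite ax0.
have t02 : t0 < 2 by apply: tlog_lt2 => //; rewrite ax0.
have t00 : 0 < t0 by lra.
have gp : 0 < `|gamma| by rewrite normr_gt0.
set b := `|gamma| in gp *.
have b2 : 0 < 2 / b by rewrite divr_gt0.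
(* The first threshold gives [2 / b <= w0], hence [w2 <= 2 w0]; the second, together with
   [ln n >= 1], keeps [s2] at most 2. *)
have [N1 HN1] := powRN_small t00 (divr_gt0 (ltr01 : 0 < 1 :> R) b2).
have t20 : 0 < 2 - t0 by lra.
have [N2 HN2] := powRN_small t00 (divr_gt0 t20 b2).
have [N3 HN3] := ln_nat_large (1 : R).
exists (maxn N1 (maxn N2 N3)) => n.
rewrite !geq_max => /and3P[/HN1 h1 /HN2 h2 /HN3 ln1].
have n1 : (1 < n)%N.
  rewrite ltnNge; apply/negP => n1; move: ln1.
  by rewrite leNgt (le_lt_trans (ln_le0 _))// -[leRHS]/(1%:R) ler_nat.
have n0 : 0 < n%:R :> R by rewrite ltr0n ltnW.
set l := ln n%:R in ln1 *; have l0 : 0 < l by lra.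
set w0 := n%:R `^ t0; have w00 : 0 < w0 by exact: powR_gt0.
have bw1 : 2 / b <= w0.
  move: h1; rewrite powRN -/w0 ler_pdivlMr// ler_pdivrMl//.
  by rewrite mulr1.
have bw2 : 2 / b <= w0 * (2 - t0).
  by move: h2; rewrite powRN -/w0 ler_pdivlMr// ler_pdivrMl.
have [j [w1 [w2 [w01 w20 w12 Hw]]]] := frac_window w0 g0 uv vu.
rewrite -/b in w20 w12.
have w10 : 0 < w1 by lra.
have vub : 0 < (v - u) / b by rewrite divr_gt0// subr_gt0.
have w2_gt0 : 0 < w2 by lra.
move=> q.
(* The exponents with [n^s1 = w1] and [n^s2 = w2]; [theta_of] sends them to the ends of the
   interval. *)
pose s1 := ln w1 / l; pose s2 := ln w2 / l.
have powE w : 0 < w -> n%:R `^ (ln w / l) = w.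
  by move=> w_gt0; rewrite /powR gt_eqF// divfK ?gt_eqF// lnK ?posrE.
have t0E : t0 = ln w0 / l by rewrite /w0 ln_powR mulfK ?gt_eqF.
have ts1 : t0 <= s1.
  by rewrite t0E /s1 ler_pM2r ?invr_gt0// ler_ln ?posrE.
have s12 : s1 <= s2.
  by rewrite /s1 /s2 ler_pM2r ?invr_gt0// ler_ln ?posrE//; lra.
have s2t : s2 - t0 <= 2 / b / w0 / l.
  rewrite t0E /s2 -mulrBl ler_pM2r ?invr_gt0//.
  apply: le_trans (ln_sub_le w00 w2_gt0) _.
  by rewrite ler_pM2r ?invr_gt0//; lra.
have s22 : s2 <= 2.
  suff : 2 / b / w0 / l <= 2 - t0 by lra.
  rewrite ler_pdivrMr// ler_pdivrMr//; apply: (le_trans bw2).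
  by rewrite -mulrA (mulrC w0) ler_pM2l// ler_peMl// ltW.
(* On [[w1, w2]] the logarithm has slope at least [1 / w2 >= 1 / (2 w0)]. *)
have ss : (v - u) / b / (2 * w0) / l <= s2 - s1.
  rewrite /s1 /s2 -mulrBl ler_pM2r ?invr_gt0//.
  have := ln_sub_le w2_gt0 w10.
  have -> : (w1 - w2) / w2 = - ((v - u) / b / w2) by rewrite -w12; ring.
  rewrite lerNr opprB; apply: le_trans.
  rewrite ler_pM2l// lef_pV2 ?posrE//; lra.
have x0E : x0 = theta_of a t0 by rewrite tlogK.
have s11 : 1 <= s1 by lra.
have t01' : 1 <= t0 by lra.
have t0s2 : t0 <= s2 by lra.
have /andP[L1 _] := theta_of_lip a01 t01' ts1 (le_trans s12 s22).
have /andP[_ L2] := theta_of_lip a01 t01' t0s2 s22.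
have /andP[L3 _] := theta_of_lip a01 s11 s12 s22.
rewrite -x0E in L1 L2.
have ala : 0 < a * - ln a by rewrite mulr_gt0 ?oppr_gt0.
exists j, (theta_of a s1), (theta_of a s2); split.
- rewrite -subr_ge0; apply: le_trans L1.
  by rewrite mulr_ge0 ?subr_ge0// ltW// divr_gt0.
- rewrite -lerBlDl; apply: (le_trans L2).
  have -> : 2 * q = - ln a * (2 / b / w0 / l).
    by rewrite /q; field; rewrite !gt_eqF.
  by rewrite ler_pM2l// oppr_gt0.
- apply: le_trans L3.
  have -> : a * (v - u) / 8 * q
      = a * - ln a / 4 * ((v - u) / b / (2 * w0) / l).
    by rewrite /q; field; rewrite !gt_eqF.
  by rewrite ler_pM2l// divr_gt0.
- move=> x /andP[x1x xx2].
  have x_gt0 : 0 < x by apply: lt_trans x1x; exact: expR_gt0.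
  have x21 : theta_of a s2 < 1.
    by rewrite /theta_of expR_lt1 pmulr_llt0// invr_gt0; lra.
  have := tlog_lt a01 (expR_gt0 _) x1x (lt_trans xx2 x21).
  have := tlog_lt a01 x_gt0 xx2 x21.
  rewrite !theta_ofK// => h4 h3.
  apply: Hw; rewrite -(powE _ w10) -(powE _ w2_gt0).
  by rewrite !ltW ?ltr_powR_nat.
Qed.

(** * Both conditions together *)

Lemma dist_nint_scaled_error (R : realType) (a kappa c x : R) (n : nat)
    (k : int) : 0 < a -> a < x < 1 -> (0 < n)%N ->
  `|scaled_error a kappa n k x| <= c ->
  dist_nint (n%:R * x +
      kappa * x / (tlog a x * n%:R `^ (tlog a x - 1)))
    <= c / n%:R `^ (tlog a x - 1).
Proof.
move=> a0 xa n0; have t1 := tlog_gt1 a0 xa; rewrite /scaled_error.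
set t := tlog a x in t1 *.
have p0 : 0 < n%:R `^ (t - 1) by rewrite powR_gt0// ltr0n.
move: (n%:R `^ _) p0 => p p0 H; apply: (@dist_nint_le _ _ _ k).
rewrite ler_pdivlMr// -[X in _ * X](gtr0_norm p0) -normrM.
apply: le_trans H; rewrite le_eqVlt; apply/orP; left; apply/eqP; congr `|_|.
by field; rewrite !gt_eqF//; lra.
Qed.

(** The tolerance [c] is split into [c/2] for the error at [x0], [c/4] for moving [x] by up to
    [3 q], and [c/4] for freezing the exponent. *)
Lemma ae_infinite_solutions (R : realType) (a kappa c gamma : R) (I : set R) :
  0 < a < 1 -> I `<=` `[0, 1[ -> 0 < c -> gamma != 0 -> I° !=set0 ->
  {ae (@lebesgue_measure R), forall x : R, a < x < Num.sqrt a ->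
    infinite_set (solutions a kappa c gamma I x)}.
Proof.
move=> a01 I01 c0 g0 [z /nbhs_ballP[d /= d0 zI]].
have /andP[a0 a1] := a01; have la := ln_lt0 a01.
pose u := z - d / 2; pose v := z + d / 2.
have uvI y : u <= y <= v -> I y.
  move=> /andP[uy yv]; apply: zI; rewrite /ball/= ltr_norml.
  by move: uy yv; rewrite /u /v => uy yv; apply/andP; split; lra.
have uv : u < v by rewrite /u /v; lra.
have /I01 : I u by apply: uvI; rewrite lexx ltW.
have /I01 : I v by apply: uvI; rewrite lexx ltW.
rewrite /= !in_itv/= => /andP[_ v1] /andP[u0 _].
have vu : v <= u + 1 by lra.
have c20 : 0 < c / 2 by lra.
have c40 : 0 < c / 4 by lra.
have F := ae_filter_ringOfSetsType (@lebesgue_measure R).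
have close := ae_scaled_error_le kappa a01 c20.
have density := @ae_limsup_of_density R (fun n =>
  [set x | a < x < Num.sqrt a /\ solutions a kappa c gamma I x n]).
apply: (@filterS2 _ _ F _ _ _ _ close density) => {close density}.
move=> x0 near0 H x0a; apply: unbounded_infinite_set => N.
suff [n Nn []] : exists2 n, (N <= n)%N &
  (a < x0 < Num.sqrt a /\ solutions a kappa c gamma I x0 n) by exists n.
apply: H => {N}; have {}near0 := near0 x0a.
have /andP[ax0 xa0] := x0a; have x01 := lt_sqrt_lt1 a0 a1 xa0.
have x0_gt0 := lt_trans a0 ax0.
have t01 : 1 < tlog a x0 by apply: tlog_gt1 => //; rewrite ax0.
have t00 : 0 < tlog a x0 by lra.
have kap0 := normr_ge0 kappa.
have gp : 0 < `|gamma| by rewrite normr_gt0.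
(* Chosen so that [3 q = (D1 / ln n) n^(-t0)]; the factor [1 / ln n] brings the change of the scaled
   error below [c/4]. *)
pose D1 := 3 * - ln a / `|gamma|.
have D10 : 0 < D1 by rewrite divr_gt0// mulr_gt0// oppr_gt0.
pose D := c / 2 + `|kappa| + D1.
have D0 : 0 < D by rewrite /D; lra.
have [N0 HN0] := scaled_error_perturb kappa a01 x0a D0 c40.
have [N1 HN1] := frac_interval a01 g0 uv vu x0a.
move: HN0 HN1; rewrite /=; set t0 := tlog a x0 in t01 t00 * => HN0 HN1.
(* This makes [m * (3 * q)] half the length guaranteed for []x1, x2[] by [frac_interval]. *)
pose m := a * (v - u) / 48.
have m0 : 0 < m by rewrite divr_gt0// mulr_gt0// subr_gt0.
exists m => // N e e0.
have [N2 HN2] := powRN_small t00 (divr_gt0 e0 (mulr_gt0 (ltr0Sn R 1) D10)).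
have [N3 HN3] := ln_nat_large (1 + 4 * D1 / c).
have [n] := near0 (maxn (maxn N N0) (maxn N1 (maxn N2 N3))).
rewrite !geq_max => /andP[/andP[Nn N0n] /and3P[/HN1 xs /HN2 wsmall /HN3 lnbig]].
move=> [n0 [k nk]] {HN1 HN2 HN3}.
have n0r : 0 < n%:R :> R by rewrite ltr0n.
set w := n%:R `^ (- t0) in wsmall.
have w0 : 0 < w by exact: powR_gt0.
pose W := n%:R `^ t0.
have W0 : 0 < W by exact: powR_gt0.
have Ww : W * w = 1 by rewrite /W /w powRN mulfV ?gt_eqF.
rewrite -/W in xs.
set l := ln n%:R in lnbig xs.
have D1c : 0 < 4 * D1 / c by rewrite divr_gt0// mulr_gt0.
have l0 : 0 < l by lra.
set q := - ln a / _ in xs.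
have q3 : 3 * q = D1 / l * w.
  have -> : w = W^-1 by rewrite /w powRN.
  by rewrite /q /D1; field; rewrite !gt_eqF.
have Dl : D1 / l <= c / 4.
  rewrite ler_pdivrMr//.
  have -> : D1 = c / 4 * (4 * D1 / c) by field; rewrite gt_eqF.
  by rewrite ler_pM2l//; lra.
have DD1 : D1 / l <= D1 by rewrite ler_pdivrMr// ler_peMr ?ltW//; lra.
have Dl0 : 0 < D1 / l by rewrite divr_gt0.
have q0 : 0 < q.
  by rewrite -(pmulr_rgt0 _ (ltr0Sn R 2)) q3 mulr_gt0.
have [j [x1 [x2 [x01' x20 x12 Hx]]]] := xs.
pose y := (x1 + x2) / 2.
have mq : m * (3 * q) = a * (v - u) / 8 * q / 2 by rewrite /m; field.
have ymem x : `|y - x| < m * (3 * q) -> x1 < x < x2.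
  by rewrite mq ltr_norml /y => /andP[h1 h2]; apply/andP; split; lra.
have xx0 x : `|y - x| < m * (3 * q) -> `|x - x0| < 3 * q.
  move=> /ymem /andP[h1 h2].
  by rewrite ltr_norml; apply/andP; split; lra.
(* []x1, x2[] reaches at most [2 q] beyond [x0], so it lies in the ball of radius [3 q]. *)
exists n, (3 * q), y; split => //.
- rewrite mulr_gt0//= q3; apply: (@le_lt_trans _ _ (D1 * w)).
    by rewrite ler_pM2r.
  apply: (@le_lt_trans _ _ (e / 2)); last by lra.
  have -> : e / 2 = D1 * (e / (2 * D1)) by field; rewrite gt_eqF.
  by rewrite ler_pM2l.
- move=> x; rewrite /ball/= => yx.
  have x3q := xx0 x yx; rewrite q3 in x3q.
  have dx : `|W * (x - x0)| <= D1 / l.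
    have -> : D1 / l = W * (D1 / l * w) by rewrite mulrCA Ww mulr1.
    by rewrite normrM (gtr0_norm W0) ler_pM2l// ltW.
  pose A := n%:R `^ (t0 - 1) * (n%:R * x0 - k%:~R).
  have E : n%:R `^ (t0 - 1) * (n%:R * x - k%:~R) = A + W * (x - x0).
    have -> : W = n%:R * n%:R `^ (t0 - 1) by rewrite mulr_powRB1 ?ltW.
    by rewrite /A; ring.
  have {}nk : `|A + kappa * x0 / t0| <= c / 2 := nk.
  have kx0 : `|kappa * x0 / t0| <= `|kappa|.
    have xt0 : 0 < x0 / t0 by exact: divr_gt0.
    by rewrite -mulrA normrM ler_piMr// gtr0_norm// ler_pdivrMr; lra.
  have AD : `|A| <= c / 2 + `|kappa|.
    rewrite -[A](addrK (kappa * x0 / t0)) (le_trans (ler_normB _ _))//.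
    by rewrite lerD.
  have [||xa close] := HN0 n N0n n0 k x.
  + by apply: ltW; apply: (lt_le_trans x3q); rewrite ler_pM2r// /D; lra.
  + by rewrite E (le_trans (ler_normD _ _))// /D; lra.
  have /andP[ax xsa] := xa; have x_lt1 := lt_sqrt_lt1 a0 a1 xsa.
  split=> //; split=> //.
  + apply: (@dist_nint_scaled_error _ _ _ _ _ _ k) => //; first by rewrite ax.
    rewrite E in close.
    rewrite -[scaled_error _ _ _ _ _](subrK (A + W * (x - x0) + kappa * x0 / t0)).
    apply: le_trans (ler_normD _ _) _.
    have : `|A + W * (x - x0) + kappa * x0 / t0| <= c / 2 + D1 / l.
      by rewrite addrAC (le_trans (ler_normD _ _))// lerD.
    by move: close Dl; move: (D1 / l) => ?; lra.
  + have /Hx/andP[h1 h2] := ymem x yx.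
    rewrite (@frac_eq _ _ j); last by apply/andP; split; lra.
    by apply: uvI; rewrite h1.
- by move=> x; rewrite /ball/= => yx; rewrite distrC; exact: xx0.
Qed.

Theorem theorem4p1 (R : realType) (a kappa c gamma : R) (I : set R)
    (a_gt0 : 0 < a) (a_lt1 : a < 1)
    (I_itv : is_interval I) (I_neq0 : I !=set0) (I_sub : I `<=` `[0, 1[)
    (c_gt0 : 0 < c) (gamma_neq0 : gamma != 0) :
  {ae (@lebesgue_measure R), forall theta : R, a < theta < 1 ->
    (theta < Num.sqrt a -> I° !=set0 ->
       infinite_set (solutions a kappa c gamma I theta)) /\
    (Num.sqrt a < theta ->
       finite_set (solutions a kappa c gamma I theta))}.
Proof.
have a01 : 0 < a < 1 by rewrite a_gt0.
have F := ae_filter_ringOfSetsType (@lebesgue_measure R).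
have fin := ae_finite_solutions kappa gamma I a_gt0 c_gt0.
(* If the interior of [I] is empty, the first clause has a false premise and only finiteness remains
   to be shown. *)
have [I0|I0] := pselect (I° !=set0).
  have inf := ae_infinite_solutions kappa a01 I_sub c_gt0 gamma_neq0 I0.
  apply: (@filterS2 _ _ F _ _ _ _ inf fin) => x infx finx /andP[ax x1].
  split=> [xa _|]; first by apply: infx; rewrite ax.
  by apply: finx; rewrite ax.
apply: (@filterS _ _ F _ _ _ fin) => x finx xa.
by split=> [_ /I0|]; last exact: finx.
Qed.
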